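(* Let $E$ be an elliptic curve over a field $K$, $P\in E(K)$, and let $m=d_1d_2>1$ be composite with $d_1,d_2>1$ coprime proper divisors of $m$, where $\operatorname{char}K\nmid m$. If $\delta_m^P$ is reducible over $K$, then $\delta_{d_1}^P$ or $\delta_{d_2}^P$ is reducible over $K$.
   Context: For $E$ with Weierstrass coordinate functions $x,y$ and $m\in\mathbb{Z}$, $\psi_m$ is the $m$-th division polynomial ($\psi_m^2\in K[x]$), $\theta_m=x\psi_m^2-\psi_{m+1}\psi_{m-1}$, so $x([m]R)=\theta_m(x(R))/\psi_m^2(x(R))$; and $\delta_m^P=\theta_m-x(P)\psi_m^2$ if $P\ne O$, $\delta_m^P=\psi_m^2$ if $P=O$. *)

(* Defs.v *)
From HB Require Import structures.
From mathcomp Require Import all_boot all_order all_algebra.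
Set Implicit Arguments. Unset Strict Implicit. Unset Printing Implicit Defensive.
Import GRing.Theory.
Local Open Scope ring_scope.

Section Elliptic.
Variable K : fieldType.

Definition wb2 (a1 a2 : K) := a1 ^+ 2 + 4 * a2.
Definition wb4 (a1 a3 a4 : K) := 2 * a4 + a1 * a3.
Definition wb6 (a3 a6 : K) := a3 ^+ 2 + 4 * a6.
Definition wb8 (a1 a2 a3 a4 a6 : K) :=
  a1 ^+ 2 * a6 + 4 * a2 * a6 - a1 * a3 * a4 + a2 * a3 ^+ 2 - a4 ^+ 2.
Definition wdisc (a1 a2 a3 a4 a6 : K) :=
  let b2 := wb2 a1 a2 in let b4 := wb4 a1 a3 a4 in
  let b6 := wb6 a3 a6 in let b8 := wb8 a1 a2 a3 a4 a6 in
  - b2 ^+ 2 * b8 - 8 * b4 ^+ 3 - 27 * b6 ^+ 2 + 9 * b2 * b4 * b6.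

Record ell_curve := EllCurve {
  ea1 : K; ea2 : K; ea3 : K; ea4 : K; ea6 : K;
  ell_nonsing : wdisc ea1 ea2 ea3 ea4 ea6 != 0 }.

Variable E : ell_curve.
Definition b2 := wb2 (ea1 E) (ea2 E).
Definition b4 := wb4 (ea1 E) (ea3 E) (ea4 E).
Definition b6 := wb6 (ea3 E) (ea6 E).
Definition b8 := wb8 (ea1 E) (ea2 E) (ea3 E) (ea4 E) (ea6 E).

(* Points of E(K): None is the point at infinity O, Some (x,y) an affine point *)
Definition on_curve (P : option (K * K)) : bool :=
  if P is Some (x, y) then
    y ^+ 2 + ea1 E * x * y + ea3 E * y
      == x ^+ 3 + ea2 E * x ^+ 2 + ea4 E * x + ea6 E
  else true.

(* F = psi_2^2 = (2y + a1 x + a3)^2 = 4x^3 + b2 x^2 + 2 b4 x + b6 *)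
Definition Fpsi2 : {poly K} :=
  4%:P * 'X ^+ 3 + b2%:P * 'X ^+ 2 + (2 * b4)%:P * 'X + b6%:P.

Definition fpsi3 : {poly K} :=
  3%:P * 'X ^+ 4 + b2%:P * 'X ^+ 3 + (3 * b4)%:P * 'X ^+ 2 + (3 * b6)%:P * 'X
  + b8%:P.

Definition fpsi4 : {poly K} :=
  2%:P * 'X ^+ 6 + b2%:P * 'X ^+ 5 + (5 * b4)%:P * 'X ^+ 4
  + (10 * b6)%:P * 'X ^+ 3 + (10 * b8)%:P * 'X ^+ 2
  + (b2 * b8 - b4 * b6)%:P * 'X + (b4 * b8 - b6 ^+ 2)%:P.

(* Reduced division polynomials f_m in K[x]:
   psi_m = f_m (m odd), psi_m = (2y + a1 x + a3) f_m (m even).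
   Given s = [f_0; ...; f_(k-1)], compute f_k via the standard recurrences
   psi_{2n+1} = psi_{n+2} psi_n^3 - psi_{n-1} psi_{n+1}^3   (n >= 2)
   psi_2 psi_{2n} = psi_n (psi_{n+2} psi_{n-1}^2 - psi_{n-2} psi_{n+1}^2) (n >= 3). *)
Definition dp_next (s : seq {poly K}) : {poly K} :=
  let f i := s`_i in
  match size s with
  | 0 => 0
  | 1 => 1
  | 2 => 1
  | 3 => fpsi3
  | 4 => fpsi4
  | k =>
    let n := k./2 in
    if odd k then
      if odd n then
        f n.+2 * f n ^+ 3 - Fpsi2 ^+ 2 * f n.-1 * f n.+1 ^+ 3
      else
        Fpsi2 ^+ 2 * f n.+2 * f n ^+ 3 - f n.-1 * f n.+1 ^+ 3
    else
      f n * (f n.+2 * f n.-1 ^+ 2 - f n.-2 * f n.+1 ^+ 2)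
  end.

Fixpoint dp_seq (N : nat) : seq {poly K} :=
  if N is N'.+1 then rcons (dp_seq N') (dp_next (dp_seq N')) else [::].

Definition fdiv (m : nat) : {poly K} := (dp_seq m.+1)`_m.

Definition psi_sq (m : nat) : {poly K} :=
  if odd m then fdiv m ^+ 2 else Fpsi2 * fdiv m ^+ 2.

(* theta_m = x psi_m^2 - psi_{m+1} psi_{m-1}  (for m >= 1) *)
Definition theta (m : nat) : {poly K} :=
  'X * psi_sq m - (if odd m then Fpsi2 else 1) * fdiv m.+1 * fdiv m.-1.

Definition delta (P : option (K * K)) (m : nat) : {poly K} :=
  if P is Some (x0, _) then theta m - x0%:P * psi_sq m else psi_sq m.

End Elliptic.

Definition reducible_poly (K : fieldType) (p : {poly K}) : Prop :=
  (1 < size p)%N /\ ~ irreducible_poly p.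

(* Main.v *)
Require Import Defs.
From Stdlib Require Import Classical.
From HB Require Import structures.
From mathcomp Require Import all_boot all_order all_algebra all_field.
From mathcomp Require Import ring zify.
Set Implicit Arguments. Unset Strict Implicit. Unset Printing Implicit Defensive.
Import GRing.Theory.
Local Open Scope ring_scope.

(** If [P = O], one of [d1], [d2] is odd, and then [delta] is the square of a
   nonconstant polynomial.  If [P] is affine, [delta_m] is monic of degree
   [m ^ 2], and its roots are the [x(R)] with [m R = P] or
   [m R = - P].  Suppose [delta_{d1}] and [delta_{d2}] are irreducible.  For
   such an [R], [x(d2 R)] is a root of [delta_{d1}] and lies in [K(x(R))], so
   [d1 ^ 2] divides the degree of every irreducible factor of [delta_m]; so does
   [d2 ^ 2], hence [m ^ 2], and [delta_m] is irreducible.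

   The group law only enters through the identity
   [delta_{k n} = psi_n ^ (2 k^2) * delta_k (theta_n / psi_n ^ 2)], which is
   obtained from recurrences alone.  The recurrences defining [psi] imply the
   full elliptic relation, so that [k |-> psi_{k n}] obeys the same recurrences
   up to scaling and is determined by [psi_{2n}], [psi_{3n}], [psi_{4n}]; these
   are computed in terms of [theta_n / psi_n ^ 2] by means of a conserved
   quantity of the Somos-4 recurrence. *)

(** * Elliptic sequences *)

Section EllipticSequence.
Variables (L : fieldType) (w : nat -> L).
Hypotheses (w0 : w 0 = 0) (w1 : w 1 = 1) (w2_neq0 : w 2 != 0).
Hypothesis w_odd : forall k,
  w k.*2.+3 = w k.+3 * w k.+1 ^+ 3 - w k * w k.+2 ^+ 3.
Hypothesis w_even : forall k,
  w k.*2.+4 * w 2 = w k.+2 * (w k.+4 * w k.+1 ^+ 2 - w k * w k.+3 ^+ 2).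

(* The values at 0 extend [w] by [w (-1) = - 1]. *)
Let X k := if k is j.+1 then w j.+2 * w j else - 1.
Let Z k := if k is j.+1 then w j.+3 * w j else - w 2.

Let evenrel p q :=
  w (p + q) * w (p - q) = X p * w q ^+ 2 - X q * w p ^+ 2.
Let oddrel p q := w (p + q).+1 * w (p - q) * w 2 =
  Z p * (w q.+1 * w q) - Z q * (w p.+1 * w p).

(* The products [w (a + b) * w (a - b)] are the 2x2 minors of the vectors
   [(X a, w a ^+ 2)], so the Pluecker relation on the vectors of indices
   [(p + q + 1) / 2], [(p + q - 1) / 2], [(p - q + 1) / 2], [(p - q - 1) / 2]
   yields the relation at [(p, q)]; for half-integral indices the odd minors
   play the same role. *)
Lemma elliptic_rels N :
  (forall p q, (p.*2 <= N)%N -> (q <= p)%N -> evenrel p q) /\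
  (forall p q, (p.*2 < N)%N -> (q <= p)%N -> oddrel p q).
Proof.
elim: N => [|N [IHe IHo]].
  split=> // p q; rewrite leqn0 double_eq0 => /eqP -> ; rewrite leqn0 => /eqP ->.
  by rewrite /evenrel /X w0; ring.
have He p q a b : (p.*2 <= N)%N -> (q <= p)%N -> a = (p + q)%N -> (b + q)%N = p ->
    w a * w b = X p * w q ^+ 2 - X q * w p ^+ 2.
  by move=> lpN lqp -> bqp; rewrite -(IHe p q lpN lqp); congr (_ * w _); lia.
have Ho p q a b : (p.*2 < N)%N -> (q <= p)%N -> a = (p + q).+1 -> (b + q)%N = p ->
    w a * w b * w 2 = Z p * (w q.+1 * w q) - Z q * (w p.+1 * w p).
  by move=> lpN lqp -> bqp; rewrite -(IHo p q lpN lqp); congr (_ * w _ * _); lia.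
split=> p q lpN lqp.
  have [/IHe|ltN] := leqP p.*2 N; first exact.
  case: q lqp => [|[|q]] lqp.
  - by rewrite /evenrel /= addn0 subn0 w0; ring.
  - by case: p lpN lqp ltN => // p _ _ _; rewrite /evenrel addn1 subn1 /= w0 w1; ring.
  have [pq|pq|lt_qp] : [\/ p = q.+2, p = q.+3 | (q.+3 < p)%N].
    by have [||] := ltngtP p q.+3; [constructor 1; lia | constructor 3; lia | constructor 2].
  - by rewrite /evenrel pq subnn w0; ring.
  - rewrite /evenrel pq (_ : q.+3 + q.+2 = q.+1.*2.+3)%N; last by lia.
    by rewrite (_ : q.+3 - q.+2 = 1)%N ?w1; [rewrite w_odd /X; ring | lia].
  (* The pair at hand is [(p, q + 2)]. For odd [p - q] the four indices are [q + h + 4],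
     [q + h + 3], [h + 2], [h + 1]; for even [p - q] they are half-integral and odd minors take
     over. *)
  have [h [he|ho]] : exists h, p = (q + h.*2 + 5)%N \/ p = (q + h.*2 + 4)%N.
    exists ((p - q - 4)./2); lia.
  - rewrite /evenrel (_ : p + q.+2 = (q + h + 3).*2.+1)%N; last by lia.
    rewrite (_ : p - q.+2 = h.*2.+3)%N; last by lia.
    have -> : X p = w p.+1 * w p.-1 by rewrite he addnS.
    rewrite /X.
    have H1 := He (q + h + 4)%N (q + h + 3)%N (q + h + 3).*2.+1 1%N
       ltac:(lia) ltac:(lia) ltac:(lia) ltac:(lia).
    have H2 := He (h + 2)%N (h + 1)%N h.*2.+3 1%N
       ltac:(lia) ltac:(lia) ltac:(lia) ltac:(lia).
    have H3 := He (q + h + 4)%N (h + 2)%N p.+1 q.+2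
       ltac:(lia) ltac:(lia) ltac:(lia) ltac:(lia).
    have H4 := He (q + h + 3)%N (h + 1)%N p.-1 q.+2
       ltac:(lia) ltac:(lia) ltac:(lia) ltac:(lia).
    have H5 := He (q + h + 4)%N (h + 1)%N p q.+3
       ltac:(lia) ltac:(lia) ltac:(lia) ltac:(lia).
    have H6 := He (q + h + 3)%N (h + 2)%N p q.+1
       ltac:(lia) ltac:(lia) ltac:(lia) ltac:(lia).
    rewrite w1 in H1 H2; rewrite mulr1 in H1; rewrite mulr1 in H2.
    transitivity ((w p.+1 * w q.+2) * (w p.-1 * w q.+2)
                  - (w p * w q.+3) * (w p * w q.+1)); last by ring.
    by rewrite H1 H2 H3 H4 H5 H6; ring.
  rewrite /evenrel (_ : p + q.+2 = (q + h + 3).*2)%N; last by lia.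
  rewrite (_ : p - q.+2 = h.*2.+2)%N; last by lia.
  have -> : X p = w p.+1 * w p.-1 by rewrite ho addnS.
  rewrite /X.
  have H1 := Ho (q + h + 3)%N (q + h + 2)%N (q + h + 3).*2 1%N
     ltac:(lia) ltac:(lia) ltac:(lia) ltac:(lia).
  have H2 := Ho (h + 1)%N h h.*2.+2 1%N
     ltac:(lia) ltac:(lia) ltac:(lia) ltac:(lia).
  have H3 := Ho (q + h + 3)%N (h + 1)%N p.+1 q.+2
     ltac:(lia) ltac:(lia) ltac:(lia) ltac:(lia).
  have H4 := Ho (q + h + 2)%N h p.-1 q.+2
     ltac:(lia) ltac:(lia) ltac:(lia) ltac:(lia).
  have H5 := Ho (q + h + 3)%N h p q.+3
     ltac:(lia) ltac:(lia) ltac:(lia) ltac:(lia).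
  have H6 := Ho (q + h + 2)%N (h + 1)%N p q.+1
     ltac:(lia) ltac:(lia) ltac:(lia) ltac:(lia).
  rewrite w1 in H1 H2; rewrite mulr1 in H1; rewrite mulr1 in H2.
  (* Each odd minor carries a factor [w 2], so every product of two minors carries [w 2 ^+ 2]. *)
  apply: (mulIf (expf_neq0 2 w2_neq0)).
  transitivity ((w p.+1 * w q.+2 * w 2) * (w p.-1 * w q.+2 * w 2)
                  - (w p * w q.+3 * w 2) * (w p * w q.+1 * w 2)); last by ring.
  rewrite H3 H4 H5 H6.
  transitivity ((w (q + h + 3).*2 * w 2) * (w h.*2.+2 * w 2)); first by ring.
  by rewrite H1 H2; ring.
have [/IHo|ltN] := ltnP p.*2 N; first exact.
case: q lqp => [|[|q]] lqp.
- by rewrite /oddrel /= addn0 subn0 w0; ring.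
- by case: p lpN lqp ltN => // p _ _ _; rewrite /oddrel addn1 subn1 /= w0 w1; ring.
have [pq|[pq|[pq|lt_qp]]] : p = q.+2 \/ p = q.+3 \/ p = q.+4 \/ (q.+4 < p)%N.
  lia.
- by rewrite /oddrel pq subnn w0; ring.
- rewrite /oddrel pq (_ : (q.+3 + q.+2).+1 = q.+1.*2.+4)%N; last by lia.
  rewrite (_ : q.+3 - q.+2 = 1)%N ?w1; last by lia.
  by rewrite mulr1 w_even /Z; ring.
- have H1 := He q.+4 2%N q.+2.+4 q.+2
     ltac:(lia) ltac:(lia) ltac:(lia) ltac:(lia).
  have H2 := He q.+3 2%N q.+1.+4 q.+1
     ltac:(lia) ltac:(lia) ltac:(lia) ltac:(lia).
  rewrite /oddrel pq (_ : (q.+4 + q.+2).+1 = q.+2.*2.+3)%N; last by lia.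
  rewrite (_ : q.+4 - q.+2 = 2)%N ?w1; last by lia.
  rewrite /X in H1 H2; rewrite w1 mulr1 in H1; rewrite w1 mulr1 in H2.
  rewrite w_odd /Z.
  transitivity ((w q.+2.+4 * w q.+2) * w q.+3 ^+ 2
                - (w q.+1.+4 * w q.+1) * w q.+4 ^+ 2); last by ring.
  by rewrite H1 H2; ring.
have ZE k : (0 < k)%N -> Z k = w k.+2 * w k.-1 by case: k.
(* The first two indices now differ by two instead of one: their minor supplies the factor [w 2]
   present in [oddrel]. *)
have [h [he|ho]] : exists h, p = (q + h.*2 + 5)%N \/ p = (q + h.*2 + 6)%N.
  exists ((p - q - 5)./2); lia.
- rewrite /oddrel ZE; last by lia.
  rewrite (_ : (p + q.+2).+1 = (q + h + 4).*2)%N; last by lia.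
  rewrite (_ : p - q.+2 = h.*2.+3)%N; last by lia.
  rewrite /Z.
  have H1 := He (q + h + 5)%N (q + h + 3)%N (q + h + 4).*2 2%N
     ltac:(lia) ltac:(lia) ltac:(lia) ltac:(lia).
  have H2 := He (h + 2)%N (h + 1)%N h.*2.+3 1%N
     ltac:(lia) ltac:(lia) ltac:(lia) ltac:(lia).
  have H3 := He (q + h + 5)%N (h + 2)%N p.+2 q.+3
     ltac:(lia) ltac:(lia) ltac:(lia) ltac:(lia).
  have H4 := He (q + h + 3)%N (h + 1)%N p.-1 q.+2
     ltac:(lia) ltac:(lia) ltac:(lia) ltac:(lia).
  have H5 := He (q + h + 5)%N (h + 1)%N p.+1 q.+4
     ltac:(lia) ltac:(lia) ltac:(lia) ltac:(lia).
  have H6 := He (q + h + 3)%N (h + 2)%N p q.+1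
     ltac:(lia) ltac:(lia) ltac:(lia) ltac:(lia).
  rewrite w1 mulr1 in H2.
  transitivity ((w p.+2 * w q.+3) * (w p.-1 * w q.+2)
                  - (w p.+1 * w q.+4) * (w p * w q.+1)); last by ring.
  rewrite mulrAC.
  by rewrite H1 H2 H3 H4 H5 H6; ring.
rewrite /oddrel ZE; last by lia.
rewrite (_ : (p + q.+2).+1 = (q + h + 4).*2.+1)%N; last by lia.
rewrite (_ : p - q.+2 = h.+2.*2)%N; last by lia.
rewrite /Z.
have H1 := Ho (q + h + 5)%N (q + h + 3)%N (q + h + 4).*2.+1 2%N
   ltac:(lia) ltac:(lia) ltac:(lia) ltac:(lia).
have H2 := Ho (h + 2)%N (h + 1)%N h.+2.*2 1%N
   ltac:(lia) ltac:(lia) ltac:(lia) ltac:(lia).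
have H3 := Ho (q + h + 5)%N (h + 2)%N p.+2 q.+3
   ltac:(lia) ltac:(lia) ltac:(lia) ltac:(lia).
have H4 := Ho (q + h + 3)%N (h + 1)%N p.-1 q.+2
   ltac:(lia) ltac:(lia) ltac:(lia) ltac:(lia).
have H5 := Ho (q + h + 5)%N (h + 1)%N p.+1 q.+4
   ltac:(lia) ltac:(lia) ltac:(lia) ltac:(lia).
have H6 := Ho (q + h + 3)%N (h + 2)%N p q.+1
   ltac:(lia) ltac:(lia) ltac:(lia) ltac:(lia).
rewrite w1 mulr1 in H2.
apply: (mulIf (expf_neq0 2 w2_neq0)).
transitivity ((w p.+2 * w q.+3 * w 2) * (w p.-1 * w q.+2 * w 2)
                - (w p.+1 * w q.+4 * w 2) * (w p * w q.+1 * w 2)); last by ring.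
rewrite H3 H4 H5 H6.
transitivity ((w (q + h + 4).*2.+1 * w 2 * w 2) * (w h.+2.*2 * w 2)); first by ring.
by rewrite H1 H2; ring.
Qed.

Lemma elliptic_rel p q : (0 < q <= p)%N -> w (p + q) * w (p - q) =
  w p.+1 * w p.-1 * w q ^+ 2 - w q.+1 * w q.-1 * w p ^+ 2.
Proof.
move=> /andP[q_gt0 le_qp]; have [He _] := elliptic_rels p.*2.
by move: (He p q (leqnn _) le_qp); rewrite /evenrel; case: p q q_gt0 le_qp {He} => [|p] [].
Qed.

Lemma somos4 k : w k.+4 * w k = w 2 ^+ 2 * w k.+3 * w k.+1 - w 3 * w k.+2 ^+ 2.
Proof.
have := @elliptic_rel k.+2 2 isT; rewrite addn2 subn2 /= w1 => ->; ring.
Qed.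

Lemma somos5 k : w k.+4.+1 * w k * w 2 =
  w 3 * w 2 * w k.+4 * w k.+1 - w 4 * w k.+3 * w k.+2.
Proof.
have [_ /(_ k.+2 2%N)] := elliptic_rels k.+2.*2.+1.
rewrite /oddrel addn2 subn2 /= w1 => -> //; ring.
Qed.

(** The three instances of [elliptic_rel] are the minors of the vectors [(X a, w a ^+ 2)] at
    [a = (k + 2) n], [(k + 1) n], [n]; eliminating the first coordinates gives a homogeneous form of
    [w_odd]. *)
Lemma odd_multiple_rel n k : w (k.*2.+3 * n) * w n ^+ 3 =
  w (k.+3 * n) * w (k.+1 * n) ^+ 3 - w (k * n) * w (k.+2 * n) ^+ 3.
Proof.
case: (posnP n) => [->|n_gt0]; first by rewrite !muln0 w0; ring.
have H1 := @elliptic_rel (k.+2 * n) (k.+1 * n) ltac:(nia).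
have H2 := @elliptic_rel (k.+2 * n) n ltac:(nia).
have H3 := @elliptic_rel (k.+1 * n) n ltac:(nia).
rewrite (_ : k.+2 * n + k.+1 * n = k.*2.+3 * n)%N in H1; last by nia.
rewrite (_ : k.+2 * n - k.+1 * n = n)%N in H1; last by nia.
rewrite (_ : k.+2 * n + n = k.+3 * n)%N in H2; last by nia.
rewrite (_ : k.+2 * n - n = k.+1 * n)%N in H2; last by nia.
rewrite (_ : k.+1 * n + n = k.+2 * n)%N in H3; last by nia.
rewrite (_ : k.+1 * n - n = k * n)%N in H3; last by nia.
transitivity (w (k.*2.+3 * n) * w n * w n ^+ 2); first by ring.
transitivity (w (k.+3 * n) * w (k.+1 * n) * w (k.+1 * n) ^+ 2
              - w (k.+2 * n) * w (k * n) * w (k.+2 * n) ^+ 2); last by ring.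
by rewrite H1 H2 H3; ring.
Qed.

Lemma even_multiple_rel n k : w (k.*2.+4 * n) * w (2 * n) * w n ^+ 2 =
  w (k.+2 * n) * (w (k.+4 * n) * w (k.+1 * n) ^+ 2
                  - w (k * n) * w (k.+3 * n) ^+ 2).
Proof.
case: (posnP n) => [->|n_gt0]; first by rewrite !muln0 w0; ring.
have H1 := @elliptic_rel (k.+3 * n) (k.+1 * n) ltac:(nia).
have H2 := @elliptic_rel (k.+3 * n) n ltac:(nia).
have H3 := @elliptic_rel (k.+1 * n) n ltac:(nia).
rewrite (_ : k.+3 * n + k.+1 * n = k.*2.+4 * n)%N in H1; last by nia.
rewrite (_ : k.+3 * n - k.+1 * n = 2 * n)%N in H1; last by nia.
rewrite (_ : k.+3 * n + n = k.+4 * n)%N in H2; last by nia.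
rewrite (_ : k.+3 * n - n = k.+2 * n)%N in H2; last by nia.
rewrite (_ : k.+1 * n + n = k.+2 * n)%N in H3; last by nia.
rewrite (_ : k.+1 * n - n = k * n)%N in H3; last by nia.
transitivity (w (k.+4 * n) * w (k.+2 * n) * w (k.+1 * n) ^+ 2
              - w (k.+2 * n) * w (k * n) * w (k.+3 * n) ^+ 2); last by ring.
by rewrite H1 H2 H3; ring.
Qed.

(** Strong induction: the recurrences determine a sequence from its first terms, and they are
    homogeneous when the term of index [k] has weight [k ^ 2]. The even recurrence is divided by the
    term of index 2, hence [z 2 != 0]. *)
Lemma scaled_multiples n (z : nat -> L) :
  w n != 0 -> z 2 != 0 -> z 0 = 0 -> z 1 = 1 ->
  (forall k, z k.*2.+3 = z k.+3 * z k.+1 ^+ 3 - z k * z k.+2 ^+ 3) ->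
  (forall k, z k.*2.+4 * z 2
     = z k.+2 * (z k.+4 * z k.+1 ^+ 2 - z k * z k.+3 ^+ 2)) ->
  w (2 * n) = w n ^+ 4 * z 2 -> w (3 * n) = w n ^+ 9 * z 3 ->
  w (4 * n) = w n ^+ 16 * z 4 ->
  forall k, w (k * n) = w n ^+ (k ^ 2) * z k.
Proof.
move=> wn0 z2_neq0 z0 z1 z_odd z_even W2 W3 W4; elim/ltn_ind => k IH.
have [k_le4|k_gt4] := leqP k 4.
  case: k k_le4 {IH} => [|[|[|[|[|]]]]] // _.
    by rewrite mul0n w0 z0 mulr0.
  by rewrite mul1n z1 mulr1.
have [j [kE|kE]] : exists j, k = j.+1.*2.+3 \/ k = j.+1.*2.+4.
  by exists (k - 5)./2; lia.
- apply: (mulIf (expf_neq0 3 wn0)); rewrite kE odd_multiple_rel !IH; try lia.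
  rewrite z_odd.
  transitivity (w n ^+ (j.+4 ^ 2 + j.+2 ^ 2 * 3) * z j.+4 * z j.+2 ^+ 3
    - w n ^+ (j.+1 ^ 2 + j.+3 ^ 2 * 3) * z j.+1 * z j.+3 ^+ 3).
    by rewrite !exprD !exprM; ring.
  have -> : (j.+4 ^ 2 + j.+2 ^ 2 * 3 = j.+1.*2.+3 ^ 2 + 3)%N by nia.
  have -> : (j.+1 ^ 2 + j.+3 ^ 2 * 3 = j.+1.*2.+3 ^ 2 + 3)%N by nia.
  by rewrite exprD; ring.
(* The exponent 6 collects [w n ^+ 4] from [w (2 * n)] and the [w n ^+ 2] in [even_multiple_rel]. *)
apply: (mulIf z2_neq0); apply: (mulIf (expf_neq0 6 wn0)).
transitivity (w (k * n) * (w n ^+ 4 * z 2) * w n ^+ 2); first by ring.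
rewrite -W2 kE even_multiple_rel !IH; try lia.
have -> : w n ^+ (j.+1.*2.+4 ^ 2) * z j.+1.*2.+4 * z 2 * w n ^+ 6
  = w n ^+ (j.+1.*2.+4 ^ 2 + 6) * (z j.+1.*2.+4 * z 2) by rewrite exprD; ring.
rewrite z_even.
transitivity (w n ^+ (j.+3 ^ 2 + j.+4.+1 ^ 2 + j.+2 ^ 2 * 2)
    * z j.+3 * z j.+4.+1 * z j.+2 ^+ 2
  - w n ^+ (j.+3 ^ 2 + j.+1 ^ 2 + j.+4 ^ 2 * 2)
    * z j.+3 * z j.+1 * z j.+4 ^+ 2).
  by rewrite !exprD !exprM; ring.
have -> : (j.+3 ^ 2 + j.+4.+1 ^ 2 + j.+2 ^ 2 * 2 = j.+1.*2.+4 ^ 2 + 6)%N by nia.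
have -> : (j.+3 ^ 2 + j.+1 ^ 2 + j.+4 ^ 2 * 2 = j.+1.*2.+4 ^ 2 + 6)%N by nia.
by ring.
Qed.

(** * Double, triple and quadruple indices *)

Variables (F C G f4 : L).
Hypotheses (w2E : w 2 ^+ 2 = F) (w4E : w 4 = w 2 * f4) (w3_neq0 : w 3 != 0).
Hypotheses (f4E : f4 = C * w 3 - F ^+ 2) (FG : F * G = C ^+ 2 + 4 * w 3).

Lemma somos5_reduced k : w k.+4.+1 * w k =
  w 3 * w k.+4 * w k.+1 - f4 * w k.+3 * w k.+2.
Proof. by apply: (mulIf w2_neq0); rewrite somos5 w4E; ring. Qed.

(** [C] is the conserved quantity of Somos-4. Instead of an induction, [w (k + 5)] is eliminated
    between [somos5_reduced] and [somos4], with [f4E] fixing the constant; thus no term whose index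
    depends on [k] is divided out. *)
Lemma somos_invariant k : w k.+4 * w k.+1 ^+ 2 + w k * w k.+3 ^+ 2
  + F * w k.+2 ^+ 3 = C * w k.+3 * w k.+2 * w k.+1.
Proof.
have S5 := somos5_reduced k; have S4 := somos4 k; have S4' := somos4 k.+1.
rewrite w2E in S4 S4'; apply: (mulfI w3_neq0).
transitivity (w k.+1 * (w k.+4.+1 * w k)
  - w k.+1 * (w k.+4.+1 * w k - (w 3 * w k.+4 * w k.+1 - f4 * w k.+3 * w k.+2))
  + f4 * w k.+1 * w k.+2 * w k.+3
  + w 3 * (w k * w k.+3 ^+ 2 + F * w k.+2 ^+ 3)); first by ring.
rewrite {2}S5 subrr.
transitivity (w k * (w k.+4.+1 * w k.+1)
  + f4 * w k.+1 * w k.+2 * w k.+3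
  + w 3 * (w k * w k.+3 ^+ 2 + F * w k.+2 ^+ 3)); first by ring.
rewrite S4'.
transitivity (F * w k.+2 * (w k.+4 * w k)
  + f4 * w k.+1 * w k.+2 * w k.+3 + w 3 * F * w k.+2 ^+ 3); first by ring.
by rewrite S4 f4E; ring.
Qed.

(* With [x_n = x - u / v], these are [F], [C = F' / 2], [psi_3] and
   [psi_4 / psi_2] at [x_n], times the power of [v] that clears denominators.
   The coefficients are Taylor coefficients, as [G = F'' / 2] and
   [psi_3' = 3 F]. *)
Let Fh u v := F * v ^+ 3 - 2 * C * u * v ^+ 2 + G * u ^+ 2 * v - 4 * u ^+ 3.
Let Ch u v := C * v ^+ 2 - G * u * v + 6 * u ^+ 2.
Let f3h u v := w 3 * v ^+ 4 - 3 * F * u * v ^+ 3 + 3 * C * u ^+ 2 * v ^+ 2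
  - G * u ^+ 3 * v + 3 * u ^+ 4.
Let f4h u v := Ch u v * f3h u v - Fh u v ^+ 2.

Lemma F_neq0 : F != 0. Proof. by rewrite -w2E expf_neq0. Qed.

Lemma double_sqr n : (1 < n)%N ->
  w (2 * n) ^+ 2 = w n ^+ 2 * Fh (w n.+1 * w n.-1) (w n ^+ 2).
Proof.
case: n => [|[|k]] //= _.
have I1 := somos4 k; have I2 := somos_invariant k; have D := w_even k.
rewrite w2E in I1; rewrite (_ : k.*2.+4 = 2 * k.+2)%N in D; last by lia.
apply: (mulIf F_neq0); rewrite -{1}w2E -exprMn D.
move: I1 I2; set d := w k; set p := w k.+1; set q := w k.+2; set r := w k.+3.
set c := w k.+4 => I1 I2.
(* The square of [c p^2 - d r^2] is expressed by the sum of the two terms, known from [I2], and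
   their product, known from [I1]. *)
transitivity (q ^+ 2 * ((c * p ^+ 2 + d * r ^+ 2 + F * q ^+ 3 - F * q ^+ 3) ^+ 2
                       - 4 * (c * d) * p ^+ 2 * r ^+ 2)); first by ring.
rewrite I1 I2 /Fh.
transitivity (q ^+ 2 * (F ^+ 2 * q ^+ 6 - 2 * C * F * (r * p) * q ^+ 4
  + (C ^+ 2 + 4 * w 3) * (r * p) ^+ 2 * q ^+ 2 - 4 * F * (r * p) ^+ 3)); first by ring.
by rewrite -FG; ring.
Qed.

(** [elliptic_rel] at [(2 n, n)] involves [w (2 n + 1) * w (2 n - 1)]; expanded by [w_odd], this
    product depends only on [c p^2 + d r^2], [c d], [r p] and [q], so [somos_invariant] and [somos4]
    apply again. *)
Lemma triple n : (1 < n)%N -> w n != 0 ->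
  w (3 * n) = w n * f3h (w n.+1 * w n.-1) (w n ^+ 2).
Proof.
move=> n_gt1 wn0; have W := @elliptic_rel (2 * n) n ltac:(lia).
rewrite (_ : 2 * n + n = 3 * n)%N in W; last by lia.
rewrite (_ : 2 * n - n = n)%N in W; last by lia.
rewrite (double_sqr n_gt1) in W; apply: (mulIf wn0); rewrite W {W}.
case: n n_gt1 wn0 => [|[|k]] // _ _; rewrite [k.+2.-1]/=.
have I1 := somos4 k; have I2 := somos_invariant k; rewrite w2E in I1.
rewrite (_ : (2 * k.+2).+1 = k.+1.*2.+3)%N; last by lia.
rewrite (_ : (2 * k.+2).-1 = k.*2.+3)%N; last by lia.
rewrite !w_odd.
move: I1 I2; set d := w k; set p := w k.+1; set q := w k.+2; set r := w k.+3.
set c := w k.+4 => I1 I2.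
transitivity (q ^+ 2 * (q ^+ 3 * p * r
   * (c * p ^+ 2 + d * r ^+ 2 + F * q ^+ 3 - F * q ^+ 3)
   - (c * d) * q ^+ 6 - p ^+ 4 * r ^+ 4
   - r * p * Fh (r * p) (q ^+ 2))); first by ring.
by rewrite I1 I2 /Fh /f3h; ring.
Qed.

(** The letters [g, d, p, q, r, c, e] stand for [w] at [n - 3, ..., n + 3]. By the even and odd
    recurrences, the left side times [w (2 n)] is [w (4 n) * w 2 ^+ 2]. *)
Lemma quadruple_core (c d e g p q r : L) :
  c * d = F * p * r - w 3 * q ^+ 2 ->
  c * p ^+ 2 + d * r ^+ 2 + F * q ^+ 3 = C * p * q * r ->
  e * p = F * c * q - w 3 * r ^+ 2 ->
  e * d = w 3 * c * p - f4 * r * q ->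
  g * r = F * d * q - w 3 * p ^+ 2 ->
  g * c = w 3 * d * r - f4 * q * p ->
  r * (e * q ^+ 2 - p * c ^+ 2) * (r * p ^+ 3 - d * q ^+ 3) ^+ 2
  - p * (r * d ^+ 2 - g * q ^+ 2) * (c * q ^+ 3 - p * r ^+ 3) ^+ 2
  = F * f4h (r * p) (q ^+ 2).
Proof.
move=> I1 I2 Ep Ed Gr Gc.
(* Regrouped so that [e] occurs only in [e p], [e d] and [g] only in [g r], [g c], which the
   hypotheses rewrite without any division. *)
transitivity ((r * p ^+ 3 - d * q ^+ 3) * r
  * (q ^+ 2 * (p ^+ 2 * r * (e * p) - q ^+ 3 * (e * d))
     - p * c ^+ 2 * (r * p ^+ 3 - d * q ^+ 3))
  - p * (c * q ^+ 3 - p * r ^+ 3)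
    * (r * d ^+ 2 * (c * q ^+ 3 - p * r ^+ 3)
       - q ^+ 2 * (q ^+ 3 * (g * c) - p * r ^+ 2 * (g * r)))); first by ring.
rewrite Ep Ed Gr Gc f4E /f4h /Ch /f3h /Fh.
(* The cofactors come from reduction modulo a Groebner basis of [I1], [I2], [FG]. *)
apply: subr0_eq.
transitivity ((c * d - (F * p * r - w 3 * q ^+ 2))
  * (- 2 * c * d * p * q ^+ 6 * r + 2 * c * p ^+ 4 * q ^+ 3 * r ^+ 2
     + 2 * d * p ^+ 2 * q ^+ 3 * r ^+ 4 + 2 * p ^+ 5 * r ^+ 5
     - 4 * p ^+ 2 * q ^+ 6 * r ^+ 2 * F + 4 * p * q ^+ 8 * r * w 3)
  + (c * p ^+ 2 + d * r ^+ 2 + F * q ^+ 3 - C * p * q * r)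
  * (- c * p ^+ 5 * r ^+ 3 - d * p ^+ 3 * r ^+ 5 - p ^+ 4 * q * r ^+ 4 * C
     + 4 * p ^+ 3 * q ^+ 3 * r ^+ 3 * F - 2 * p ^+ 2 * q ^+ 5 * r ^+ 2 * w 3
     + q ^+ 9 * F ^+ 2 - q ^+ 9 * C * w 3)
  + (F * G - (C ^+ 2 + 4 * w 3))
  * (p ^+ 5 * q ^+ 2 * r ^+ 5 - p ^+ 2 * q ^+ 8 * r ^+ 2 * F
     + p * q ^+ 10 * r * w 3)); first by ring.
by rewrite I1 I2 FG !subrr !mul0r !addr0.
Qed.

Lemma quadruple n : (1 < n)%N ->
  w (4 * n) = w (2 * n) * f4h (w n.+1 * w n.-1) (w n ^+ 2).
Proof.
case: n => [|[|k]] //= _.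
have I1 := somos4 k; have I2 := somos_invariant k.
have Ep := somos4 k.+1; have Ed := somos5_reduced k.
rewrite w2E in I1 Ep.
(* [g] stands for [w (n - 3)], where [n = k + 2]. *)
pose g := if k is j.+1 then w j else -1.
have [Gr Gc] : w k.+3 * g = F * w k.+2 * w k - w 3 * w k.+1 ^+ 2 /\
   w k.+4 * g = w 3 * w k.+3 * w k - f4 * w k.+2 * w k.+1.
  rewrite {}/g; case: k {I1 I2 Ep Ed} => [|j]; last first.
    by rewrite somos5_reduced somos4 w2E.
  by rewrite w0 w1 w4E; split; ring.
have D2 : w (k.+3 * 2) * w 2 = w k.+3 * (w k.+4.+1 * w k.+2 ^+ 2 - w k.+1 * w k.+4 ^+ 2).
  by rewrite -w_even; congr (w _ * _); lia.
have D1 : w k.+1.*2 * w 2 = w k.+1 * (w k.+3 * w k ^+ 2 - g * w k.+2 ^+ 2).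
  rewrite /g; case: (k) => [|j]; first by rewrite w0 w1; ring.
  by rewrite -w_even; congr (w _ * _); lia.
have D4 := w_even (k.*2.+2).
rewrite (_ : k.*2.+2.*2.+4 = 4 * k.+2)%N in D4; last by lia.
rewrite (_ : k.*2.+2.+4 = k.+3 * 2)%N in D4; last by lia.
rewrite (_ : k.*2.+2.+3 = k.+1.*2.+3)%N in D4; last by lia.
rewrite !w_odd in D4.
rewrite (_ : k.*2.+4 = 2 * k.+2)%N in D4; last by lia.
rewrite (_ : k.*2.+2 = k.+1.*2)%N in D4; last by lia.
have K : _ = F * f4h (w k.+3 * w k.+1) (w k.+2 ^+ 2) :=
  @quadruple_core (w k.+4) (w k) (w k.+4.+1) g (w k.+1) (w k.+2) (w k.+3)
    _ _ _ _ _ _.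
apply: (mulIf F_neq0); rewrite -mulrA [f4h _ _ * F]mulrC -K; first last.
- by rewrite mulrC Gc; ring.
- by rewrite mulrC Gr; ring.
- by rewrite Ed; ring.
- by rewrite Ep; ring.
- by rewrite I2; ring.
- by rewrite I1; ring.
rewrite -w2E expr2 mulrA D4.
transitivity (w (2 * k.+2) * ((w (k.+3 * 2) * w 2)
   * (w k.+3 * w k.+1 ^+ 3 - w k * w k.+2 ^+ 3) ^+ 2
   - (w k.+1.*2 * w 2) * (w k.+4 * w k.+2 ^+ 3 - w k.+1 * w k.+3 ^+ 3) ^+ 2)).
  by ring.
by rewrite D1 D2; ring.
Qed.

End EllipticSequence.

(** * Multiplication by [n] on division polynomials *)

Section DivisionPolynomials.
Variables (K : fieldType) (E : ell_curve K).

Lemma size_dp_seq N : size (dp_seq E N) = N.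
Proof. by elim: N => //= N IH; rewrite size_rcons IH. Qed.

Lemma nth_dp_seq N i : (i < N)%N -> (dp_seq E N)`_i = fdiv E i.
Proof.
elim: N => // N IH; rewrite ltnS leq_eqVlt => /orP[/eqP <- //|lt_iN].
by rewrite /= nth_rcons size_dp_seq lt_iN IH.
Qed.

Lemma fdivE m : fdiv E m = dp_next E (dp_seq E m).
Proof. by rewrite /fdiv /= nth_rcons size_dp_seq ltnn eqxx. Qed.

Lemma fdiv_odd k : fdiv E k.*2.+3 =
  if odd k then Fpsi2 E ^+ 2 * fdiv E k.+3 * fdiv E k.+1 ^+ 3
                - fdiv E k * fdiv E k.+2 ^+ 3
  else fdiv E k.+3 * fdiv E k.+1 ^+ 3
       - Fpsi2 E ^+ 2 * fdiv E k * fdiv E k.+2 ^+ 3.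
Proof.
case: k => [|k]; first by rewrite !fdivE /dp_next /=; ring.
rewrite fdivE doubleS.
have nthE i : (i < k.*2.+2.+3)%N -> _ := @nth_dp_seq _ i.
have := size_dp_seq k.*2.+2.+3; move: (dp_seq _ _) nthE => s nthE szs.
rewrite /dp_next szs (_ : k.*2.+2.+3./2 = k.+2); last by lia.
by rewrite /= negbK odd_double /= !nthE; [case: (odd k) | lia..].
Qed.

Lemma fdiv_even k : fdiv E k.*2.+4 = fdiv E k.+2 *
  (fdiv E k.+4 * fdiv E k.+1 ^+ 2 - fdiv E k * fdiv E k.+3 ^+ 2).
Proof.
case: k => [|k]; first by rewrite !fdivE /dp_next /=; ring.
rewrite fdivE doubleS.
have nthE i : (i < k.*2.+2.+4)%N -> _ := @nth_dp_seq _ i.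
have := size_dp_seq k.*2.+2.+4; move: (dp_seq _ _) nthE => s nthE szs.
rewrite /dp_next szs (_ : k.*2.+2.+4./2 = k.+3); last by lia.
by rewrite /= !negbK odd_double /= !nthE //; lia.
Qed.

(* [s] plays the role of [psi_2 = 2 y + a1 x + a3]. *)
Definition psi_seq (L : fieldType) (phi : {poly K} -> L) (s : L) k :=
  (if odd k then 1 else s) * phi (fdiv E k).

Section PsiSeq.
Variables (L : fieldType) (phi : {rmorphism {poly K} -> L}) (s : L).
Hypothesis sE : s ^+ 2 = phi (Fpsi2 E).
Local Notation w := (psi_seq phi s).

Lemma psi_seq0 : w 0 = 0. Proof. by rewrite /psi_seq rmorph0 mulr0. Qed.

Lemma psi_seq1 : w 1 = 1. Proof. by rewrite /psi_seq rmorph1 mulr1. Qed.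

Lemma psi_seq2 : w 2 = s. Proof. by rewrite /psi_seq rmorph1 mulr1. Qed.

Lemma psi_seq3 : w 3 = phi (fpsi3 E). Proof. by rewrite /psi_seq mul1r. Qed.

Lemma psi_seq4 : w 4 = s * phi (fpsi4 E). Proof. by []. Qed.

Lemma psi_seq_odd k :
  w k.*2.+3 = w k.+3 * w k.+1 ^+ 3 - w k * w k.+2 ^+ 3.
Proof.
rewrite /psi_seq fdiv_odd /= odd_double negbK /=.
by case: (odd k); rewrite /= rmorphB !(rmorphXn, rmorphM) /= -sE; ring.
Qed.

Lemma psi_seq_even k : w k.*2.+4 * w 2
  = w k.+2 * (w k.+4 * w k.+1 ^+ 2 - w k * w k.+3 ^+ 2).
Proof.
rewrite psi_seq2 /psi_seq fdiv_even /= odd_double !negbK /=.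
by case: (odd k); rewrite /= !(rmorphB, rmorphXn, rmorphM) /=; ring.
Qed.

Lemma psi_seq_sqr k : w k ^+ 2 = phi (psi_sq E k).
Proof.
rewrite /psi_seq /psi_sq exprMn.
by case: (odd k); rewrite !(rmorphXn, rmorphM) /= ?sE ?expr1n ?mul1r.
Qed.

Lemma psi_seq_theta k : (0 < k)%N ->
  phi (theta E k) = phi 'X * w k ^+ 2 - w k.+1 * w k.-1.
Proof.
case: k => // k _; rewrite psi_seq_sqr /psi_seq /theta /= !negbK.
rewrite !(rmorphB, rmorphM) /=; congr (_ - _).
by case: (odd k); rewrite /= -?sE ?rmorph1; ring.
Qed.

End PsiSeq.

(** Half the derivative of [Fpsi2], given by coefficients so that it makes sense in characteristic
    2. *)
Definition Fderiv_half : {poly K} := 6%:P * 'X ^+ 2 + (b2 E)%:P * 'X + (b4 E)%:P.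

Definition Fderiv2_half : {poly K} := 12%:P * 'X + (b2 E)%:P.

(** Both identities below, which supply [f4E] and [FG], hold up to a multiple of this relation. *)
Lemma b8_rel : 4 * b8 E = b2 E * b6 E - b4 E ^+ 2.
Proof. by rewrite /b8 /b2 /b6 /b4 /wb8 /wb2 /wb4 /wb6; ring. Qed.

Lemma fpsi4E : fpsi4 E = Fderiv_half * fpsi3 E - Fpsi2 E ^+ 2.
Proof.
apply/eqP; rewrite -subr_eq0.
have -> : fpsi4 E - (Fderiv_half * fpsi3 E - Fpsi2 E ^+ 2)
   = (4 * b8 E - (b2 E * b6 E - b4 E ^+ 2))%:P * 'X ^+ 2.
  by rewrite /fpsi4 /Fderiv_half /fpsi3 /Fpsi2; ring.
by rewrite b8_rel subrr mul0r.
Qed.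

Lemma Fderiv_rel : Fpsi2 E * Fderiv2_half = Fderiv_half ^+ 2 + 4 * fpsi3 E.
Proof.
apply/eqP; rewrite -subr_eq0.
have -> : Fpsi2 E * Fderiv2_half - (Fderiv_half ^+ 2 + 4 * fpsi3 E)
   = - (4 * b8 E - (b2 E * b6 E - b4 E ^+ 2))%:P.
  by rewrite /Fderiv2_half /Fderiv_half /fpsi3 /Fpsi2; ring.
by rewrite b8_rel subrr oppr0.
Qed.

(** * Evaluation at the [n]-th multiple of the generic point *)

Section Multiplication.
Variables (L : fieldType) (iota : {rmorphism {poly K} -> L}) (s : L).
Hypotheses (sE : s ^+ 2 = iota (Fpsi2 E)) (s_neq0 : s != 0).
Hypothesis fpsi3_neq0 : iota (fpsi3 E) != 0.
Local Notation w := (psi_seq iota s).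

(* [phi] is evaluation at the abscissa of the [n]-th multiple of the generic
   point, and [s'] below is the value of [psi_2] there. *)
Variables (phi : {rmorphism {poly K} -> L}) (n : nat).
Hypotheses (n_gt1 : (1 < n)%N) (wn_neq0 : w n != 0) (w2n_neq0 : w (2 * n) != 0).
Hypothesis phiC : forall c, phi c%:P = iota c%:P.
Hypothesis phiX : phi 'X = iota (theta E n) / iota (psi_sq E n).

Let s' := w (2 * n) / w n ^+ 4.

Let u := w n.+1 * w n.-1.
Let v := w n ^+ 2.
Let t := u / v.

Let v_neq0 : v != 0. Proof. exact: expf_neq0. Qed.

Let uE : u = t * v. Proof. by rewrite divfK. Qed.

Let phiXt : phi 'X = iota 'X - t.
Proof.
by rewrite phiX -(psi_seq_sqr sE) (psi_seq_theta sE) ?(ltnW n_gt1) // mulrBl mulfK.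
Qed.

Let w2_neq0 : w 2 != 0. Proof. by rewrite psi_seq2. Qed.

Let w3_neq0 : w 3 != 0. Proof. by rewrite psi_seq3. Qed.

Let w2E : w 2 ^+ 2 = iota (Fpsi2 E). Proof. by rewrite psi_seq2. Qed.

Let w4E : w 4 = w 2 * iota (fpsi4 E). Proof. by rewrite psi_seq2. Qed.

Let f4E : iota (fpsi4 E) =
  iota Fderiv_half * w 3 - iota (Fpsi2 E) ^+ 2.
Proof. by rewrite psi_seq3 fpsi4E rmorphB rmorphXn rmorphM. Qed.

Let FG : iota (Fpsi2 E) * iota Fderiv2_half = iota Fderiv_half ^+ 2 + 4 * w 3.
Proof.
by rewrite psi_seq3 -rmorphM Fderiv_rel rmorphD rmorphXn rmorphM rmorph_nat.
Qed.

(** This and the next two facts are Taylor expansions at [iota 'X - t], cleared of denominators;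
    they identify [Fh], [Ch], [f3h] with values of [phi]. *)
Let phiF : v ^+ 3 * phi (Fpsi2 E) = iota (Fpsi2 E) * v ^+ 3
  - 2 * iota Fderiv_half * u * v ^+ 2 + iota Fderiv2_half * u ^+ 2 * v - 4 * u ^+ 3.
Proof.
rewrite uE /Fderiv_half /Fderiv2_half /Fpsi2.
by rewrite !(rmorphD, rmorphXn, rmorphM) /= !phiC phiXt; ring.
Qed.

Let phiFd : v ^+ 2 * phi Fderiv_half = iota Fderiv_half * v ^+ 2
  - iota Fderiv2_half * u * v + 6 * u ^+ 2.
Proof.
rewrite uE /Fderiv_half /Fderiv2_half.
by rewrite !(rmorphD, rmorphXn, rmorphM) /= !phiC phiXt; ring.
Qed.

Let phi3 : v ^+ 4 * phi (fpsi3 E) = w 3 * v ^+ 4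
  - 3 * iota (Fpsi2 E) * u * v ^+ 3 + 3 * iota Fderiv_half * u ^+ 2 * v ^+ 2
  - iota Fderiv2_half * u ^+ 3 * v + 3 * u ^+ 4.
Proof.
rewrite psi_seq3 uE /Fderiv_half /Fderiv2_half /fpsi3 /Fpsi2.
by rewrite !(rmorphD, rmorphXn, rmorphM) /= !phiC phiXt; ring.
Qed.

Let s'E : s' ^+ 2 = phi (Fpsi2 E).
Proof.
have := double_sqr (psi_seq0 _ _) (psi_seq1 _ _) w2_neq0 (psi_seq_odd sE)
  (psi_seq_even _ _) w2E w4E w3_neq0 f4E FG n_gt1.
rewrite -/u -/v -phiF => W; rewrite expr_div_n W /v.
by field.
Qed.

(** By [s'E] the sequence on the right obeys the same recurrences, so [scaled_multiples] reduces the
    claim to [k = 2, 3, 4]: the definition of [s'], [triple] and [quadruple]. *)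
Lemma psi_seq_mul k : w (k * n) = w n ^+ (k ^ 2) * psi_seq phi s' k.
Proof.
have z2 : psi_seq phi s' 2 = s' by rewrite psi_seq2.
apply: (scaled_multiples (psi_seq0 _ _) (psi_seq1 _ _) w2_neq0
  (psi_seq_odd sE) (psi_seq_even _ _) wn_neq0 _ (psi_seq0 _ _) (psi_seq1 _ _)
  (psi_seq_odd s'E) (psi_seq_even _ _)) => //.
- by rewrite z2 mulf_neq0 ?invr_neq0 ?expf_neq0.
- by rewrite z2 mulrC divfK ?expf_neq0.
- rewrite (triple (psi_seq0 _ _) (psi_seq1 _ _) w2_neq0 (psi_seq_odd sE)
    (psi_seq_even _ _) w2E w4E w3_neq0 f4E FG n_gt1) //.
  by rewrite -/u -/v -phi3 psi_seq3 /v; ring.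
rewrite (quadruple (psi_seq0 _ _) (psi_seq1 _ _) w2_neq0 (psi_seq_odd sE)
    (psi_seq_even _ _) w2E w4E w3_neq0 f4E FG n_gt1) //.
rewrite -/u -/v -phi3 -phiF -phiFd psi_seq4 fpsi4E rmorphB rmorphXn rmorphM.
by rewrite /s' /v; field.
Qed.

Lemma psi_sq_mul k :
  iota (psi_sq E (k * n)) = iota (psi_sq E n) ^+ (k ^ 2) * phi (psi_sq E k).
Proof.
by rewrite -!(psi_seq_sqr sE) -(psi_seq_sqr s'E) psi_seq_mul exprMn exprAC.
Qed.

(** [theta] involves the indices [k n + 1] and [k n - 1], which are not multiples of [n];
    [elliptic_rel] at [(k n, n)] trades them for [(k + 1) n] and [(k - 1) n]. *)
Lemma theta_mul k : (0 < k)%N ->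
  iota (theta E (k * n)) = iota (psi_sq E n) ^+ (k ^ 2) * phi (theta E k).
Proof.
move=> k_gt0; apply: (mulIf v_neq0).
rewrite (psi_seq_theta sE) ?(psi_seq_theta s'E) //; last by lia.
have W := elliptic_rel (psi_seq0 iota s) (psi_seq1 _ _) w2_neq0 (psi_seq_odd sE)
  (psi_seq_even _ _) (p := k * n) (q := n) ltac:(nia).
rewrite (_ : k * n + n = k.+1 * n)%N in W; last by lia.
rewrite (_ : k * n - n = k.-1 * n)%N in W; last by nia.
rewrite -/u -/v in W.
rewrite -(psi_seq_sqr sE) -/v mulrBl phiXt.
transitivity (iota 'X * w (k * n) ^+ 2 * v
  - (w (k * n).+1 * w (k * n).-1 * v - u * w (k * n) ^+ 2) - u * w (k * n) ^+ 2).
  by ring.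
rewrite -W !psi_seq_mul uE /v.
have -> : w n ^+ (k.+1 ^ 2) * psi_seq phi s' k.+1 * (w n ^+ (k.-1 ^ 2) * psi_seq phi s' k.-1)
   = w n ^+ (k ^ 2 + (k ^ 2 + 2)) * (psi_seq phi s' k.+1 * psi_seq phi s' k.-1).
  rewrite (_ : k ^ 2 + (k ^ 2 + 2) = k.+1 ^ 2 + k.-1 ^ 2)%N; last by nia.
  by rewrite exprD; ring.
rewrite !exprD exprAC.
by ring.
Qed.

Lemma delta_mul P k : (0 < k)%N ->
  iota (delta E P (k * n)) = iota (psi_sq E n) ^+ (k ^ 2) * phi (delta E P k).
Proof.
move=> k_gt0; case: P => [[x0 y0]|] /=; last exact: psi_sq_mul.
by rewrite rmorphB [phi _]rmorphB !rmorphM phiC theta_mul // psi_sq_mul; ring.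
Qed.

End Multiplication.
End DivisionPolynomials.

(** * Degrees *)

Section LeadingCoefficients.
Variables (K : fieldType).

(** The coefficient [c] may be zero, so that formal degrees can be computed in every
    characteristic. *)
Definition has_lead (p : {poly K}) d c := (size p <= d.+1)%N /\ p`_d = c.

Lemma has_leadM p q d e a b :
  has_lead p d a -> has_lead q e b -> has_lead (p * q) (d + e) (a * b).
Proof.
move=> [sp <-] [sq <-]; split.
  by have := size_polyMleq p q; lia.
rewrite coefM (bigD1 (Ordinal (ltn_addr e (ltnSn d)))) //= addKn big1 ?addr0 //.
case=> i lt_i; rewrite -val_eqE /= => neq_id; have [lt_id|lt_di|/eqP] := ltngtP i d.
- by rewrite [q`__]nth_default ?mulr0 //; apply: leq_trans sq _; lia.
- by rewrite [p`__]nth_default ?mul0r //; apply: leq_trans sp _.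
- by rewrite (negPf neq_id).
Qed.

Lemma has_leadX p d a n : has_lead p d a -> has_lead (p ^+ n) (d * n) (a ^+ n).
Proof.
move=> Hp; elim: n => [|n IHn]; first by rewrite muln0 /has_lead size_poly1 coef1.
by rewrite !exprS mulnS; apply: has_leadM.
Qed.

Lemma has_leadB p q d e a b :
  has_lead p d a -> has_lead q e b -> e = d -> has_lead (p - q) d (a - b).
Proof.
move=> [sp <-] + ed; rewrite {e}ed => -[sq <-]; split; last by rewrite coefB.
by rewrite (leq_trans (size_polyD _ _)) // size_polyN geq_max sp sq.
Qed.

Lemma has_lead_eq p d a d' a' :
  has_lead p d a -> d = d' -> a = a' -> has_lead p d' a'.
Proof. by move=> Hp <- <-. Qed.

Lemma has_lead_size p d a : has_lead p d a -> a != 0 -> size p = d.+1.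
Proof.
move=> [sp <-] nz; apply/eqP; rewrite eqn_leq sp ltnNge.
by apply: contraNN nz => le_pd; rewrite nth_default.
Qed.

Lemma has_lead_Poly (s : seq K) :
  has_lead (Poly s) (size s).-1 s`_(size s).-1.
Proof.
split; last by rewrite coef_Poly.
by rewrite (leq_trans (size_Poly _)) // leqSpred.
Qed.

Variable E : ell_curve K.
Local Notation f := (fdiv E).

Lemma Fpsi2_Poly : Fpsi2 E = Poly [:: b6 E; 2 * b4 E; b2 E; 4].
Proof. by rewrite /= !cons_poly_def /Fpsi2 mul0r add0r; ring. Qed.

Lemma fpsi3_Poly : fpsi3 E = Poly [:: b8 E; 3 * b6 E; 3 * b4 E; b2 E; 3].
Proof. by rewrite /= !cons_poly_def /fpsi3 mul0r add0r; ring. Qed.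

Lemma fpsi4_Poly : fpsi4 E = Poly [:: b4 E * b8 E - b6 E ^+ 2;
  b2 E * b8 E - b4 E * b6 E; 10 * b8 E; 10 * b6 E; 5 * b4 E; b2 E; 2].
Proof. by rewrite /= !cons_poly_def /fpsi4 mul0r add0r; ring. Qed.

Lemma has_lead_F : has_lead (Fpsi2 E) 3 4.
Proof. by rewrite Fpsi2_Poly; apply: has_lead_Poly. Qed.

(* Odd and even indices are separated to avoid halves: the leading coefficient is
   [m] for odd [m] and [m / 2] for even [m]. *)
Lemma has_lead_fdiv i :
  has_lead (f i.*2.+1) (2 * i * i.+1) (i.*2.+1)%:R /\
  has_lead (f i.*2.+2) (2 * i * i.+2) (i.+1)%:R.
Proof.
elim/ltn_ind: i => -[|[|i]] IH.
- by rewrite !fdivE /dp_next /has_lead /= size_poly1 coef1.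
- rewrite !fdivE /dp_next /= fpsi3_Poly fpsi4_Poly.
  by split; apply: has_lead_Poly.
have F2 := has_leadX 2 has_lead_F.
have [a [ia|ia]] : exists a, i = a.*2 \/ i = a.*2.+1 by exists i./2; lia.
  have [O0 E0] := IH a ltac:(lia); have [O1 E1] := IH a.+1 ltac:(lia).
  rewrite !doubleS in O1 E1; set o := has_lead (f _) _ _.
  have O : o.
    rewrite /o -[i.+2.*2]/i.+1.*2.+2 fdiv_odd /= ia odd_double /=.
    apply: has_lead_eq (has_leadB
      (has_leadM (has_leadM F2 E1) (has_leadX 3 E0))
      (has_leadM O0 (has_leadX 3 O1)) _) _ _; [nia | nia | rewrite -!muln2; ring].
  split=> //; rewrite -[i.+2.*2]/i.+1.*2.+2 fdiv_even ia.
  (* For [a = 0] the induction hypothesis does not reach index 5, but [O] has just settled it. *)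
  have O2 : has_lead (f a.*2.+1.+4) (2 * a.+2 * a.+3) (a.+2.*2.+1)%:R.
    case: (posnP a) => [a0|a_gt0].
      by move: O; rewrite /o ia a0.
    by have [] := IH a.+2 ltac:(lia); rewrite !doubleS.
  apply: has_lead_eq (has_leadM O1 (has_leadB
      (has_leadM O2 (has_leadX 2 E0))
      (has_leadM O0 (has_leadX 2 E1)) _)) _ _; [nia | nia | rewrite -!muln2; ring].
have [O0 E0] := IH a ltac:(lia); have [O1 E1] := IH a.+1 ltac:(lia).
have [O2 E2] := IH a.+2 ltac:(lia).
rewrite !doubleS in O1 E1 O2 E2; rewrite -[i.+2.*2]/i.+1.*2.+2 fdiv_odd fdiv_even.
rewrite /= ia /= negbK odd_double /=; split.
  apply: has_lead_eq (has_leadB (has_leadM O2 (has_leadX 3 O1))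
    (has_leadM (has_leadM F2 E0) (has_leadX 3 E1)) _) _ _; [nia | nia | rewrite -!muln2; ring].
apply: has_lead_eq (has_leadM E1 (has_leadB
    (has_leadM E2 (has_leadX 2 O1))
    (has_leadM E0 (has_leadX 2 O2)) _)) _ _; [nia | nia | rewrite -!muln2; ring].
Qed.

Lemma has_lead_fdiv_odd m : odd m -> has_lead (f m) (m ^ 2)./2 m%:R.
Proof.
move=> m_odd; have [+ _] := has_lead_fdiv m./2.
rewrite (_ : m./2.*2.+1 = m); last by lia.
by move/has_lead_eq; apply=> //; have -> : m = m./2.*2.+1 by [lia]; nia.
Qed.

Lemma has_lead_fdiv_even m : ~~ odd m -> (0 < m)%N ->
  has_lead (f m) (m ^ 2 - 4)./2 (m./2)%:R.
Proof.
move=> m_even m_gt0; have [_] := has_lead_fdiv m./2.-1.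
rewrite (_ : m./2.-1.*2.+2 = m); last by lia.
rewrite (_ : m./2.-1.+1 = m./2); last by lia.
by move/has_lead_eq; apply=> //; have -> : m = m./2.-1.*2.+2 by [lia]; nia.
Qed.

Lemma has_lead_psi_sq m : (0 < m)%N ->
  has_lead (psi_sq E m) (m ^ 2).-1 (m ^ 2)%:R.
Proof.
move=> m_gt0; rewrite /psi_sq; case: ifP => m_odd.
  apply: has_lead_eq (has_leadX 2 (has_lead_fdiv_odd m_odd)) _ _.
    have -> : m = m./2.*2.+1 by lia.
    by nia.
  by rewrite natrX.
have Hf := has_lead_fdiv_even (negbT m_odd) m_gt0.
apply: has_lead_eq (has_leadM has_lead_F (has_leadX 2 Hf)) _ _.
  have -> : m = m./2.-1.*2.+2 by lia.
  by nia.
have -> : (m ^ 2 = 4 * m./2 ^ 2)%N by have {1}-> : m = m./2.*2 by [lia]; nia.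
by rewrite natrM natrX.
Qed.

(** The leading coefficients combine to [m^2 - (m + 1) (m - 1) = 1], so [theta] is monic in every
    characteristic. *)
Lemma has_lead_theta m : (1 < m)%N -> has_lead (theta E m) (m ^ 2) 1.
Proof.
move=> m_gt1; rewrite /theta.
have HX : has_lead 'X 1 (1 : K) by rewrite /has_lead size_polyX coefX.
have Hm := has_leadM HX (has_lead_psi_sq (ltnW m_gt1)).
case: ifP => m_odd.
  have Hs := @has_lead_fdiv_even m.+1 ltac:(lia) ltac:(lia).
  have Hp := @has_lead_fdiv_even m.-1 ltac:(lia) ltac:(lia).
  have [j mE] : exists j, m = j.+1.*2.+1 by exists m./2.-1; lia.
  apply: has_lead_eq (has_leadB Hm (has_leadM (has_leadM has_lead_F Hs) Hp) _) _ _.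
  - by rewrite mE; nia.
  - by nia.
  have [-> ->] : m.+1./2 = j.+2 /\ m.-1./2 = j.+1 by lia.
  by rewrite mE -muln2; ring.
have Hs := @has_lead_fdiv_odd m.+1 ltac:(lia).
have Hp := @has_lead_fdiv_odd m.-1 ltac:(lia).
have [j mE] : exists j, m = j.*2.+2 by exists m./2.-1; lia.
(* The factor 1 in [theta] for even [m] is read as ['X ^+ 0]. *)
apply: has_lead_eq (has_leadB Hm (has_leadM (has_leadM (has_leadX 0 HX) Hs) Hp) _) _ _.
- by rewrite mE; nia.
- by nia.
by rewrite mE /= -muln2; ring.
Qed.

Lemma size_psi_sq m : (m%:R : K) != 0 -> size (psi_sq E m) = (m ^ 2)%N.
Proof.
move=> mn0; have m_gt0 : (0 < m)%N by case: m mn0; rewrite ?eqxx.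
rewrite (has_lead_size (has_lead_psi_sq m_gt0)) ?natrX ?expf_neq0 //.
by rewrite prednK // expn_gt0 m_gt0.
Qed.

Lemma psi_sq_neq0 m : (m%:R : K) != 0 -> psi_sq E m != 0.
Proof.
move=> mn0; rewrite -size_poly_eq0 size_psi_sq //.
by case: m mn0; rewrite ?eqxx.
Qed.

Lemma size_delta_Some P m : (1 < m)%N -> size (delta E (Some P) m) = (m ^ 2).+1.
Proof.
case: P => x0 y0 m_gt1; apply: has_lead_size (oner_neq0 K).
(* The constant is given formal degree 1 with coefficient 0, so that its product with [psi_sq] has
   formal degree [m ^ 2], like [theta]. *)
have HC : has_lead x0%:P 1 0 by rewrite /has_lead coefC (leq_trans (size_polyC_leq1 _)).
apply: has_lead_eq (has_leadB (has_lead_theta m_gt1)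
  (has_leadM HC (has_lead_psi_sq (ltnW m_gt1))) _) _ _ => //.
  by nia.
by rewrite mul0r subr0.
Qed.

Lemma fdiv_neq0 m : (m%:R : K) != 0 -> f m != 0.
Proof.
move/psi_sq_neq0; apply: contraNneq => fm0.
by rewrite /psi_sq fm0 expr0n /= mulr0 if_same.
Qed.

(** The leading coefficient is [m], not [2 m], so characteristic 2 is covered. *)
Lemma fdiv_double_neq0 m : (m%:R : K) != 0 -> f (2 * m) != 0.
Proof.
move=> mn0; have m_gt0 : (0 < m)%N by case: m mn0; rewrite ?eqxx.
have := @has_lead_fdiv_even (2 * m) ltac:(lia) ltac:(lia).
rewrite (_ : (2 * m)./2 = m); last by lia.
by move/has_lead_size => /(_ mn0) sz; rewrite -size_poly_eq0 sz.
Qed.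

Lemma wdisc_neq0 :
  - b2 E ^+ 2 * b8 E - 8 * b4 E ^+ 3 - 27 * b6 E ^+ 2 + 9 * b2 E * b4 E * b6 E != 0.
Proof. exact: ell_nonsing. Qed.

(** If all coefficients vanished, then [b2 = b6 = 2 b4 = 0] would annihilate every term of the
    discriminant. *)
Lemma Fpsi2_neq0 : Fpsi2 E != 0.
Proof.
apply: contra_neq wdisc_neq0 => F0.
have c i : (Poly [:: b6 E; 2 * b4 E; b2 E; 4])`_i = 0 by rewrite -Fpsi2_Poly F0 coef0.
have := c 0; have := c 1; have := c 2%N; rewrite !coef_Poly /= => B2 B4 B6.
transitivity (- 4 * (2 * b4 E) * b4 E ^+ 2); last by rewrite B4; ring.
by rewrite B2 B6; ring.
Qed.

(** Vanishing would give [b2 = b8 = 3 b6 = 0], then [b4 ^+ 2 = 0] by [b8_rel], and the discriminant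
    would be zero. *)
Lemma fpsi3_neq0 : fpsi3 E != 0.
Proof.
apply: contra_neq wdisc_neq0 => F0.
have c i : (Poly [:: b8 E; 3 * b6 E; 3 * b4 E; b2 E; 3])`_i = 0.
  by rewrite -fpsi3_Poly F0 coef0.
have := c 0; have := c 1; have := c 3%N; rewrite !coef_Poly /= => B2 B6 B8.
transitivity (- (8 * b4 E * (4 * b8 E - (b2 E * b6 E - b4 E ^+ 2)))
    - 9 * (3 * b6 E) * b6 E); last by rewrite b8_rel B6; ring.
by rewrite B2 B8; ring.
Qed.

End LeadingCoefficients.

(** * Degrees of irreducible factors *)

Lemma sqrt_extension (F : fieldType) (a : F) :
  exists (L : fieldType) (f : {rmorphism F -> L}) (s : L), s ^+ 2 = f a.
Proof.
have [[x xE]|nsqr] := classic (exists x, x ^+ 2 = a).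
  by exists F, idfun, x.
have sz : size ('X^2 - a%:P) = 3 by rewrite size_XnsubC.
have irr : irreducible_poly ('X^2 - a%:P).
  apply: cubic_irreducible => [|x]; rewrite ?sz //.
  apply/negP; rewrite rootE !hornerE subr_eq0 => /eqP xE; apply: nsqr.
  by exists x.
have [L _ [s + _]] := irredp_FAdjoin irr.
rewrite rootE rmorphB /= map_polyXn map_polyC !hornerE subr_eq0 => /eqP sE.
by exists L, (in_alg L), s.
Qed.

(** With [R = {poly K}] and [a = Fpsi2 E], the field [L] stands in for the function field of [E],
    and [s] for [psi_2]. *)
Lemma sqrt_embedding (R : idomainType) (a : R) :
  exists (L : fieldType) (f : {rmorphism R -> L}) (s : L),
    injective f /\ s ^+ 2 = f a.
Proof.
have [L [f [s sE]]] := @sqrt_extension {fraction R} (tofrac a).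
exists L, (f \o @tofrac R), s; split=> // p q /fmorph_inj/eqP.
by rewrite tofrac_eq => /eqP.
Qed.

Lemma exists_irreducible_factor (F : fieldType) (p : {poly F}) :
  (1 < size p)%N -> exists2 q, irreducible_poly q & q %| p.
Proof.
have [n] := ubnP (size p); elim: n p => // n IHn p lt_pn p_gt1.
have [irr|nirr] := classic (irreducible_poly p); first by exists p.
have [q [q_neq1 q_dvd q_neq]] :
    exists q : {poly F}, [/\ size q != 1, q %| p & ~~ (q %= p)].
  apply: NNPP => none; apply: nirr; split=> // q q_neq1 q_dvd.
  by apply: contra_notT none => q_neq; exists q.
have p_neq0 : p != 0 by rewrite -size_poly_gt0 ltnW.
have q_neq0 : q != 0 by apply: contraNneq p_neq0 => q0; rewrite q0 dvd0p in q_dvd.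
have lt_qp : (size q < size p)%N.
  by rewrite ltn_neqAle dvdp_leq // andbT; apply: contraNN q_neq; rewrite dvdp_size_eqp.
have q_gt1 : (1 < size q)%N by rewrite ltn_neqAle eq_sym q_neq1 size_poly_gt0.
have [r r_irr r_dvd] := IHn q ltac:(lia) q_gt1.
by exists r => //; apply: dvdp_trans q_dvd.
Qed.

Lemma irreducible_dvd_root (F L : fieldType) (f : {rmorphism F -> L})
    (p q : {poly F}) (x : L) : irreducible_poly p ->
  root (map_poly f p) x -> root (map_poly f q) x -> p %| q.
Proof.
move=> [p_gt1 irr] px qx; have [cop|] := boolP (coprimep p q).
  have := cop; rewrite -(coprimep_map f) => /coprimep_root/(_ px).
  by rewrite (rootP qx) eqxx.
rewrite /coprimep => /irr/(_ (dvdp_gcdl _ _)) gcd_p.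
by rewrite -(eqp_dvdl _ gcd_p) dvdp_gcdr.
Qed.

(** [p] is associated to the minimal polynomial of [x], whose degree is that of the subextension
    generated by [x]. *)
Lemma irreducible_root_dvd_dim (F : fieldType) (L : fieldExtType F)
    (p : {poly F}) (x : L) : irreducible_poly p ->
  root (map_poly (in_alg L) p) x -> ((size p).-1 %| \dim {:L})%N.
Proof.
move=> p_irr px; have /polyOver1P[q qE] := minPolyOver 1 x.
have p_q : p %| q.
  by apply: (irreducible_dvd_root p_irr px); rewrite -qE root_minPoly.
have q_p : q %| p.
  rewrite -(dvdp_map (in_alg L)) -qE minPoly_dvdp //.
  by apply/polyOver1P; exists p.
have <- : size q = size p by apply: eqp_size; rewrite /eqp q_p.
have := size_minPoly 1 x; rewrite qE size_map_poly => ->.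
have := field_dimS (subvf <<1; x>>%AS); rewrite dim_Fadjoin dimv1 muln1.
by [].
Qed.

Lemma map_poly_homogenize (F L : fieldType) (f : {rmorphism F -> L})
    (p : {poly F}) N (a b : L) : (size p <= N.+1)%N -> b != 0 ->
  b ^+ N * (map_poly f p).[a / b] =
  \sum_(i < N.+1) f p`_i * (a ^+ i * b ^+ (N - i)).
Proof.
move=> sz_p b_neq0; rewrite (@horner_coef_wide _ N.+1) ?size_map_poly //.
rewrite mulr_sumr; apply: eq_bigr => i _; rewrite coef_map /=.
have /subnK {1}<- : (i <= N)%N by rewrite -ltnS.
by rewrite exprD expr_div_n; field; rewrite expf_neq0.
Qed.

(** * Composition of [delta] with multiplication by [n] *)

Section Composition.
Variables (K : fieldType) (E : ell_curve K) (P : option (K * K)) (k n : nat).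
Hypotheses (k_gt1 : (1 < k)%N) (n_gt1 : (1 < n)%N) (n_neq0 : (n%:R : K) != 0).

Lemma delta_homogenize : (size (delta E P k) <= (k ^ 2).+1)%N ->
  delta E P (k * n) = \sum_(i < (k ^ 2).+1)
    (delta E P k)`_i *: (theta E n ^+ i * psi_sq E n ^+ (k ^ 2 - i)).
Proof.
move=> sz; have [L [iota [s [iota_inj sE]]]] := sqrt_embedding (Fpsi2 E).
have iota_neq0 p : p != 0 -> iota p != 0 by rewrite raddf_eq0.
pose iotaK : {rmorphism K -> L} := iota \o @polyC K.
pose x := iota (theta E n) / iota (psi_sq E n).
have cx : commr_rmorph iotaK x by move=> c; apply: mulrC.
pose phi : {rmorphism {poly K} -> L} := horner_morph cx.
have s_neq0 : s != 0.
  apply: contraNneq (iota_neq0 _ (Fpsi2_neq0 E)) => s0.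
  by rewrite -sE s0 expr0n.
have wn0 m : fdiv E m != 0 -> psi_seq E iota s m != 0.
  move=> fm0; rewrite mulf_neq0 ?iota_neq0 //.
  by case: (odd m); rewrite ?oner_neq0.
have psi_neq0 : iota (psi_sq E n) != 0 by rewrite iota_neq0 ?psi_sq_neq0.
apply: iota_inj.
rewrite (@delta_mul K E L iota s sE s_neq0 _ phi n n_gt1 _ _ _ _ P k) ?(ltnW k_gt1) //.
- rewrite [phi _]/(map_poly iotaK (delta E P k)).[x] map_poly_homogenize //.
  rewrite rmorph_sum; apply: eq_bigr => i _.
  by rewrite -mul_polyC !rmorphM !rmorphXn.
- by rewrite iota_neq0 ?fpsi3_neq0.
- by rewrite wn0 // fdiv_neq0.
- by rewrite wn0 // fdiv_double_neq0.
- by move=> c; apply: horner_morphC.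
by apply: horner_morphX.
Qed.
End Composition.

Lemma delta_factor_degree (K : fieldType) (E : ell_curve K) (P : K * K) k n A :
  (1 < k)%N -> (1 < n)%N -> (n%:R : K) != 0 ->
  irreducible_poly (delta E (Some P) k) -> irreducible_poly (delta E (Some P) n) ->
  irreducible_poly A -> A %| delta E (Some P) (k * n) ->
  (k ^ 2 %| (size A).-1)%N.
Proof.
move=> k_gt1 n_gt1 n_neq0 irr_k irr_n irr_A A_dvd.
have [L dimL [x Ax _]] := irredp_FAdjoin irr_A.
pose ev : {rmorphism {poly K} -> L} := horner_eval x \o map_poly (in_alg L).
have evE p : ev p = (map_poly (in_alg L) p).[x] by [].
have evC c : ev c%:P = in_alg L c by rewrite evE map_polyC hornerC.
set N := (k ^ 2)%N.
have sz_k : size (delta E (Some P) k) = N.+1 by apply: size_delta_Some.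
have dx : ev (delta E (Some P) (k * n)) = 0.
  by rewrite -(divpK A_dvd) rmorphM evE [ev A](rootP Ax) mulr0.
have ev_delta : ev (delta E (Some P) (k * n)) =
    \sum_(i < N.+1) in_alg L (delta E (Some P) k)`_i
      * (ev (theta E n) ^+ i * ev (psi_sq E n) ^+ (N - i)).
  rewrite delta_homogenize ?sz_k // rmorph_sum; apply: eq_bigr => i _.
  by rewrite -mul_polyC rmorphM evC rmorphM !rmorphXn.
have [psi0|psi_neq0] := eqVneq (ev (psi_sq E n)) 0; last first.
  rewrite -dimL -[N]/(N.+1.-1) -sz_k.
  apply: (@irreducible_root_dvd_dim _ _ _ (ev (theta E n) / ev (psi_sq E n)) irr_k).
  rewrite rootE -(mulrI_eq0 _ (mulfI (expf_neq0 N psi_neq0))).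
  by rewrite map_poly_homogenize ?sz_k // -ev_delta dx.
(* [psi_n ^ 2] cannot vanish at [x]: the identity would force [theta_n] to vanish
   too, and the irreducible [delta_n] would divide [psi_n ^ 2], of lower degree. *)
have theta0 : ev (theta E n) = 0.
  (* Only the term [i = N] survives, and its coefficient is the nonzero leading coefficient of
     [delta_k]. *)
  move: ev_delta; rewrite dx psi0 big_ord_recr big1 /= ?add0r => [|i _]; last first.
    by rewrite [0 ^+ _]expr0n subn_eq0 leqNgt ltn_ord !mulr0.
  rewrite subnn mulr1 => /esym/eqP; rewrite mulf_eq0 scaler_eq0 oner_eq0 orbF.
  have -> : (delta E (Some P) k)`_N = lead_coef (delta E (Some P) k).
    by rewrite lead_coefE sz_k.
  rewrite lead_coef_eq0 -size_poly_eq0 sz_k /= expf_eq0 => /andP[_ /eqP ->].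
  by [].
have : delta E (Some P) n %| psi_sq E n.
  apply: (irreducible_dvd_root irr_n (f := in_alg L) (x := x)).
    apply/rootP; rewrite -evE; case: (P) => x0 y0.
    by rewrite rmorphB rmorphM psi0 theta0 mulr0 subr0.
  by apply/rootP; rewrite -evE.
move/(dvdp_leq (psi_sq_neq0 E n_neq0)).
by rewrite size_delta_Some // size_psi_sq // ltnn.
Qed.

(** * Reducibility of [delta] *)

Lemma psi_sq_odd_reducible (K : fieldType) (E : ell_curve K) d :
  odd d -> (1 < d)%N -> (d%:R : K) != 0 -> reducible_poly (psi_sq E d).
Proof.
move=> d_odd d_gt1 d_neq0; have sz_psi := size_psi_sq E d_neq0.
split=> [|[_ irr]]; first by rewrite sz_psi; nia.
have sz_f : size (fdiv E d) = (d ^ 2)./2.+1.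
  exact: has_lead_size (has_lead_fdiv_odd E d_odd) d_neq0.
have f_dvd : fdiv E d %| psi_sq E d by rewrite /psi_sq d_odd dvdp_exp.
have f_neq1 : size (fdiv E d) != 1 by rewrite sz_f; nia.
have := eqp_size (irr _ f_neq1 f_dvd).
rewrite sz_f sz_psi; have -> : d = d./2.*2.+1 by lia.
nia.
Qed.

Theorem theorem5p2 (K : fieldType) (E : ell_curve K) (P : option (K * K))
  (hP : on_curve E P) (m d1 d2 : nat)
  (hm : m = (d1 * d2)%N) (hd1 : (1 < d1)%N) (hd2 : (1 < d2)%N)
  (hcop : coprime d1 d2) (hchar : (m%:R : K) != 0) :
  reducible_poly (delta E P m) ->
  reducible_poly (delta E P d1) \/ reducible_poly (delta E P d2).
Proof.
have [d1_neq0 d2_neq0] : (d1%:R : K) != 0 /\ (d2%:R : K) != 0.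
  by move: hchar; rewrite hm natrM mulf_eq0 => /norP[].
move=> [m_gt1 m_red]; case: P hP m_gt1 m_red => [P|] _ m_gt1 m_red /=; last first.
  (* Here [P = O]; coprime [d1] and [d2] are not both even. *)
  have [d1_odd|d1_even] := boolP (odd d1).
    by left; apply: psi_sq_odd_reducible.
  right; apply: psi_sq_odd_reducible => //.
  apply: contraLR hcop => d2_even; rewrite /coprime.
  have : (2 %| gcdn d1 d2)%N by rewrite dvdn_gcd !dvdn2 d1_even.
  by case: (gcdn d1 d2) => [|[|]].
apply: NNPP => /not_or_and[nred1 nred2].
have irr d : (1 < d)%N -> ~ reducible_poly (delta E (Some P) d) ->
    irreducible_poly (delta E (Some P) d).
  move=> d_gt1 nred; apply: NNPP => nirr; apply: nred; split=> //.
  by rewrite size_delta_Some //; nia.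
have irr1 := irr _ hd1 nred1; have irr2 := irr _ hd2 nred2.
have [A [A_irr A_dvd A_lt]] : exists A : {poly K}, [/\ irreducible_poly A,
    A %| delta E (Some P) m & (size A < (m ^ 2).+1)%N].
  have m1 : (1 < m)%N by nia.
  rewrite -(size_delta_Some E P m1).
  (* An irreducible factor of full degree would be associated to [delta_m], making it
     irreducible. *)
  apply: NNPP => none; have [A A_irr A_dvd] := exists_irreducible_factor m_gt1.
  have d_neq0 : delta E (Some P) m != 0 by rewrite -size_poly_gt0 ltnW.
  have := dvdp_leq d_neq0 A_dvd; rewrite leq_eqVlt => /orP[|lt_A]; last first.
    by apply: none; exists A.
  rewrite dvdp_size_eqp // => A_eqp; apply: m_red.
  case: A_irr => A_gt1 A_irr; split=> // q q_neq1 q_dvd.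
  by rewrite (eqp_ltrans (A_irr q q_neq1 _)) // (eqp_dvdr _ A_eqp).
have dvd1 : (d1 ^ 2 %| (size A).-1)%N.
  by apply: (delta_factor_degree hd1 hd2 d2_neq0 irr1 irr2 A_irr); rewrite -hm.
have dvd2 : (d2 ^ 2 %| (size A).-1)%N.
  apply: (delta_factor_degree hd2 hd1 d1_neq0 irr2 irr1 A_irr).
  by rewrite mulnC -hm.
have : (m ^ 2 %| (size A).-1)%N.
  by rewrite hm expnMn Gauss_dvd ?dvd1 ?dvd2 // coprimeXl ?coprimeXr.
have A_gt1 : (1 < size A)%N by case: A_irr.
(* The degree of [A] is positive and less than [m ^ 2], hence not a multiple of it. *)
move/dvdn_leq; lia.
Qed.
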